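(* Let $A=\bigoplus_{n\ge0}A^n$ be a locally finite graded complex algebra, let $P$ be the set of all graded submultiplicative seminorms on $A$, and let $\lambda(P,A)=\{a=(a_n)\in\prod_nA^n:\ \|a\|_p=\sum_np_n(a_n)<\infty\ \forall p\in P\}$ with the topology given by the seminorms $\|\cdot\|_p$, $p\in P$. Let $\iota_A\colon A\to\lambda(P,A)$ be the embedding that is the identity on each $A^n$. Then $\lambda(P,A)$ is a subalgebra of $\prod_nA^n$ with respect to the multiplication $(a_i)\cdot(b_j)=(c_k)$, $c_k=\sum_{i+j=k}a_ib_j$, and $(\lambda(P,A),\iota_A)$ is the Arens-Michael envelope of $A$.
   Context: A graded algebra $A=\bigoplus_{n\ge0}A^n$ has $A^iA^j\subset A^{i+j}$; it is locally finite if each $A^n$ is finite-dimensional; $A$ carries the finest locally convex topology and each $A^n$ its standard finite-dimensional topology. A graded submultiplicative seminorm is a family $p=(p_n)_{n\ge0}$ with $p_n$ a seminorm on $A^n$ and $p_{i+j}(ab)\le p_i(a)p_j(b)$ for $a\in A^i$, $b\in A^j$. An Arens-Michael algebra is a complete Hausdorff locally convex algebra whose topology is defined by a family of submultiplicative seminorms. The Arens-Michael envelope of a topological algebra $A$ is an Arens-Michael algebra $\widehat A$ with a continuous homomorphism $\iota_A\colon A\to\widehat A$ such that for every Arens-Michael algebra $B$ and continuous homomorphism $\varphi\colon A\to B$ there is a unique continuous homomorphism $\widehat\varphi\colon\widehat A\to B$ with $\widehat\varphi\iota_A=\varphi$. *)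

(* Defs.v *)
From HB Require Import structures.
From mathcomp Require Import all_boot all_order all_algebra.
From mathcomp Require Import all_classical all_reals all_analysis.
From mathcomp.real_closed Require Import complex.
From Stdlib Require Import ClassicalEpsilon.
Set Implicit Arguments. Unset Strict Implicit. Unset Printing Implicit Defensive.
Import Order.TTheory GRing.Theory Num.Theory.
Local Open Scope ring_scope.
Local Open Scope classical_set_scope.

Section Seminorms.
Variables (R : realType).
Local Notation C := R[i].

Definition seminorm_on (V : lmodType C) (S : set V) (p : V -> R) :=
  (forall x y, S x -> S y -> p (x + y) <= p x + p y) /\
  (forall (c : C) x, S x -> p (c *: x) = Normc.normc c * p x).

Definition lin_subspace (V : lmodType C) (S : set V) :=
  S 0 /\ (forall x y, S x -> S y -> S (x + y)) /\
  (forall (c : C) x, S x -> S (c *: x)).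

Definition alg_closed_on (V : lmodType C) (S : set V)
  (mul : V -> V -> V) (one : V) :=
  lin_subspace S /\ S one /\ (forall x y, S x -> S y -> S (mul x y)).

Definition submult_on (V : lmodType C) (S : set V) (mul : V -> V -> V)
  (q : V -> R) :=
  forall x y, S x -> S y -> q (mul x y) <= q x * q y.

(* A (linear) map f from (S1, q1) to (V2, q2) is continuous iff every q2 i
   is dominated on S1 by a multiple of a finite sum of the q1 j. *)
Definition sn_continuous (V1 V2 : lmodType C) (S1 : set V1)
  (I1 I2 : Type) (q1 : I1 -> V1 -> R) (q2 : I2 -> V2 -> R) (f : V1 -> V2) :=
  forall i2 : I2, exists (s : seq I1) (c : R),
    forall x, S1 x -> q2 i2 (f x) <= c * \sum_(j <- s) q1 j x.

Definition sn_equiv (V : lmodType C) (S : set V) (I J : Type)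
  (q : I -> V -> R) (r : J -> V -> R) :=
  sn_continuous S q r id /\ sn_continuous S r q id.

Definition sn_hausdorff (V : lmodType C) (S : set V) (I : Type)
  (q : I -> V -> R) :=
  forall x, S x -> (forall i, q i x = 0) -> x = 0.

Definition net_directed (D : Type) (le : D -> D -> Prop) :=
  inhabited D /\ (forall d, le d d) /\
  (forall a b c, le a b -> le b c -> le a c) /\
  (forall a b, exists c, le a c /\ le b c).

Definition sn_complete (V : lmodType C) (S : set V) (I : Type)
  (q : I -> V -> R) :=
  forall (D : Type) (le : D -> D -> Prop) (x : D -> V),
    net_directed le -> (forall d, S (x d)) ->
    (forall i (e : R), 0 < e -> exists d0, forall d d',
        le d0 d -> le d0 d' -> q i (x d - x d') < e) ->
    exists y, S y /\
      (forall i (e : R), 0 < e -> exists d0, forall d,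
        le d0 d -> q i (x d - y) < e).

Definition AM_algebra (V : lmodType C) (S : set V) (mul : V -> V -> V)
  (one : V) (I : Type) (q : I -> V -> R) :=
  alg_closed_on S mul one /\
  (forall i, seminorm_on S (q i)) /\
  sn_hausdorff S q /\ sn_complete S q /\
  exists (J : Type) (r : J -> V -> R),
    (forall j, seminorm_on S (r j) /\ submult_on S mul (r j)) /\
    sn_equiv S q r.

Definition hom_on (V1 V2 : lmodType C) (S1 : set V1)
  (mul1 : V1 -> V1 -> V1) (one1 : V1) (mul2 : V2 -> V2 -> V2) (one2 : V2)
  (f : V1 -> V2) :=
  (forall x y, S1 x -> S1 y -> f (x + y) = f x + f y) /\
  (forall (c : C) x, S1 x -> f (c *: x) = c *: f x) /\
  (forall x y, S1 x -> S1 y -> f (mul1 x y) = mul2 (f x) (f y)) /\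
  f one1 = one2.

Definition all_seminorms (V : lmodType C) := {p : V -> R | seminorm_on setT p}.
Definition finest_lc (V : lmodType C) (p : all_seminorms V) : V -> R :=
  proj1_sig p.

Definition AM_envelope (A : algType C) (IA : Type) (qA : IA -> A -> R)
  (T : lmodType C) (S : set T) (mul : T -> T -> T) (one : T) (I : Type)
  (q : I -> T -> R) (iota : A -> T) :=
  AM_algebra S mul one q /\
  (forall a, S (iota a)) /\
  hom_on setT *%R 1 mul one iota /\
  sn_continuous setT qA q iota /\
  forall (B : algType C) (IB : Type) (qB : IB -> B -> R),
    AM_algebra setT *%R 1 qB ->
    forall phi : A -> B,
      hom_on setT *%R 1 *%R 1 phi -> sn_continuous setT qA qB phi ->
      (exists psi : T -> B,
          hom_on S mul one *%R 1 psi /\ sn_continuous S q qB psi /\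
          forall a, psi (iota a) = phi a) /\
      (forall psi1 psi2 : T -> B,
          hom_on S mul one *%R 1 psi1 -> sn_continuous S q qB psi1 ->
          (forall a, psi1 (iota a) = phi a) ->
          hom_on S mul one *%R 1 psi2 -> sn_continuous S q qB psi2 ->
          (forall a, psi2 (iota a) = phi a) ->
          forall x, S x -> psi1 x = psi2 x).

End Seminorms.

Section Graded.
Variables (R : realType).
Local Notation C := R[i].
Variables (A : algType C) (Agr : nat -> set A).

Definition graded_algebra :=
  (forall n, lin_subspace (Agr n)) /\
  (forall a, exists (N : nat) (f : nat -> A),
      (forall n, Agr n (f n)) /\ a = \sum_(n < N) f n) /\
  (forall (N : nat) (f : nat -> A), (forall n, Agr n (f n)) ->
      \sum_(n < N) f n = 0 -> forall n, (n < N)%N -> f n = 0) /\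
  (forall i j a b, Agr i a -> Agr j b -> Agr (i + j)%N (a * b)).

Definition locally_finite :=
  forall n, exists s : seq A, (forall x, x \in s -> Agr n x) /\
    forall x, Agr n x -> exists c : nat -> C,
      x = \sum_(k < size s) c k *: s`_k.

Definition is_decomposition (a : A) (f : nat -> A) :=
  (forall n, Agr n (f n)) /\
  exists N, (forall n, (N <= n)%N -> f n = 0) /\ a = \sum_(n < N) f n.

Definition components (a : A) : nat -> A :=
  ClassicalEpsilon.epsilon (inhabits (fun _ : nat => (0 : A)))
    (is_decomposition a).

Definition iotaA (a : A) : nat -> A := components a.

Definition graded_submult_seminorm (p : nat -> A -> R) :=
  (forall n, seminorm_on (Agr n) (p n)) /\
  (forall i j a b, Agr i a -> Agr j b ->
      p (i + j)%N (a * b) <= p i a * p j b).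

Definition Pidx := {p : nat -> A -> R | graded_submult_seminorm p}.

Definition in_prod (a : nat -> A) := forall n, Agr n (a n).
Definition seq_mul (a b : nat -> A) : nat -> A :=
  fun k => \sum_(i < k.+1) a i * b (k - i)%N.
Definition seq_one : nat -> A := fun n => if n == 0%N then 1 else 0.

Definition lnorm_e (p : nat -> A -> R) (a : nat -> A) : \bar R :=
  (\sum_(n <oo) (p n (a n))%:E)%E.
Definition lnorm (p : Pidx) (a : nat -> A) : R := fine (lnorm_e (proj1_sig p) a).

Definition lambdaPA : set (nat -> A) :=
  [set a | in_prod a /\ forall p : Pidx, (lnorm_e (proj1_sig p) a < +oo)%E].

End Graded.

(* Main.v *)
(* Each graded submultiplicative seminorm p gives a submultiplicative norm
   ||.||_p by the Cauchy product estimate.  For i <= N, the l1 operator norm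
   of left multiplication by a in A^i on the truncation A / (A^{N+1} + ...)
   yields a member of P that is a norm on A^0, ..., A^N; hence lambda(P, A) is
   Hausdorff, and a Cauchy net converges in every (finite-dimensional) degree,
   the limit being approached in each ||.||_p by uniformity of the partial sums.
   If phi : A -> B is a homomorphism and r a submultiplicative seminorm of B,
   then r \o phi restricted to the A^n is a member of P, so the series
   sum_n phi(x_n) converges absolutely; its sum is the extension, and both its
   multiplicativity and its uniqueness follow from the density of A. *)
Require Import Defs.
From HB Require Import structures.
From mathcomp Require Import all_boot all_order all_algebra.
From mathcomp Require Import all_classical all_reals all_analysis.
From mathcomp.real_closed Require Import complex.
From mathcomp Require Import lra zify.
Import Order.TTheory GRing.Theory Num.Theory.
Set Implicit Arguments. Unset Strict Implicit. Unset Printing Implicit Defensive.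
Local Open Scope ring_scope.
Local Open Scope classical_set_scope.

(** * Finite Cauchy products and prefix sums *)

Lemma cauchy_product_sum (K : pzRingType) (u v : nat -> K) (N : nat) :
  \sum_(k < N) \sum_(i < k.+1) u i * v (k - i)%N =
  \sum_(i < N) u i * \sum_(j < N - i) v j.
Proof.
elim: N => [|N IH]; first by rewrite !big_ord0.
rewrite big_ord_recr /= {}IH.
(* The added term [i = N] has an empty inner sum. With it both ranges are [N.+1], and the diagonal
   [i + j = N] can be appended term by term. *)
have -> : \sum_(i < N) u i * \sum_(j < N - i) v j =
    \sum_(i < N.+1) u i * \sum_(j < N - i) v j.
  by rewrite big_ord_recr /= subnn big_ord0 mulr0 addr0.
rewrite -big_split /=; apply: eq_bigr => i _.
by rewrite subSn ?big_ord_recr /= ?mulrDr // -ltnS.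
Qed.

(** The left side runs over the triangle [i + j < N], which lies in the square [i, j < N], and all
    terms are nonnegative. *)
Lemma le_cauchy_product (K : realDomainType) (u v : nat -> K) (N : nat) :
  (forall n, 0 <= u n) -> (forall n, 0 <= v n) ->
  \sum_(k < N) \sum_(i < k.+1) u i * v (k - i)%N <=
  (\sum_(i < N) u i) * (\sum_(j < N) v j).
Proof.
move=> u0 v0; rewrite cauchy_product_sum mulr_suml; apply: ler_sum => i _.
apply: ler_wpM2l => //.
rewrite -!(big_mkord xpredT v) [leRHS](big_cat_nat (n := (N - i)%N)) ?leq_subr //=.
by rewrite lerDl; apply: sumr_ge0 => j _.
Qed.

Lemma ler_sum_prefix (K : realDomainType) (u : nat -> K) (M N : nat) :
  (forall n, 0 <= u n) -> (M <= N)%N -> \sum_(n < M) u n <= \sum_(n < N) u n.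
Proof.
move=> u0 MN; rewrite -!(big_mkord xpredT u) [leRHS](big_cat_nat (n := M)) //=.
by rewrite lerDl; apply: sumr_ge0 => j _.
Qed.

(** * Seminorms on subspaces, and Cauchy nets of real and complex numbers *)

Section Seminorms.
Variable R : realType.
Local Notation C := R[i].

Section Subspace.
Variables (V : lmodType C) (S : set V).
Hypothesis S_lin : lin_subspace S.

Lemma subspace0 : S 0. Proof. by case: S_lin. Qed.

Lemma subspaceD x y : S x -> S y -> S (x + y).
Proof. by case: S_lin => _ [+ _]; apply. Qed.

Lemma subspaceZ (c : C) x : S x -> S (c *: x).
Proof. by case: S_lin => _ [_]; apply. Qed.

Lemma subspaceN x : S x -> S (- x).
Proof. by rewrite -scaleN1r; apply: subspaceZ. Qed.

Lemma subspaceB x y : S x -> S y -> S (x - y).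
Proof. by move=> Sx Sy; apply/subspaceD/subspaceN. Qed.

Lemma subspace_sum (I : Type) (s : seq I) (P : pred I) (f : I -> V) :
  (forall i, S (f i)) -> S (\sum_(i <- s | P i) f i).
Proof.
by move=> Sf; apply: big_ind => //; [exact: subspace0|exact: subspaceD].
Qed.

Variable p : V -> R.
Hypothesis p_sn : seminorm_on S p.

Lemma seminormD x y : S x -> S y -> p (x + y) <= p x + p y.
Proof. by case: p_sn => + _; apply. Qed.

Lemma seminormZ (c : C) x : S x -> p (c *: x) = Normc.normc c * p x.
Proof. by case: p_sn => _; apply. Qed.

Lemma seminorm0 : p 0 = 0.
Proof.
by rewrite -(scale0r (0 : V)) seminormZ ?Normc.normc0 ?mul0r //; apply: subspace0.
Qed.

Lemma seminormN x : S x -> p (- x) = p x.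
Proof.
by move=> Sx; rewrite -scaleN1r seminormZ // normcN Normc.normc1 mul1r.
Qed.

(** Nonnegativity is not among the axioms of [seminorm_on]; it comes from
    [0 = p (x - x) <= p x + p x]. *)
Lemma seminorm_ge0 x : S x -> 0 <= p x.
Proof.
move=> Sx; have := seminormD Sx (subspaceN Sx).
by rewrite subrr seminorm0 seminormN //; lra.
Qed.

Lemma seminormB x y : S x -> S y -> p (x - y) <= p x + p y.
Proof.
by move=> Sx Sy; rewrite -[p y]seminormN //; apply/seminormD => //; apply/subspaceN.
Qed.

Lemma seminorm_distC x y : S x -> S y -> p (x - y) = p (y - x).
Proof. by move=> Sx Sy; rewrite -seminormN ?opprB //; apply: subspaceB. Qed.

Lemma seminorm_sum (I : Type) (s : seq I) (P : pred I) (f : I -> V) :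
  (forall i, S (f i)) -> p (\sum_(i <- s | P i) f i) <= \sum_(i <- s | P i) p (f i).
Proof.
move=> Sf; elim: s => [|i s IH]; first by rewrite !big_nil seminorm0.
rewrite !big_cons; case: (P i) => //.
apply: le_trans (seminormD _ _) _ => //; first exact: subspace_sum.
by rewrite lerD2l.
Qed.

End Subspace.

Lemma subspaceT (V : lmodType C) : lin_subspace [set: V].
Proof. by []. Qed.

(** Directedness merges the finitely many thresholds. The family [u] takes two net arguments so that
    one statement covers Cauchy conditions and, when the second argument is ignored, convergence to
    a limit. *)
Lemma directed_small (D J : Type) (le : D -> D -> Prop) (u : J -> D -> D -> R)
    (s : seq J) (c : R) :
  net_directed le -> (forall j d d', 0 <= u j d d') ->
  (forall j (e : R), 0 < e -> exists d0, forall d d',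
     le d0 d -> le d0 d' -> u j d d' < e) ->
  forall e : R, 0 < e -> exists d0, forall d d',
     le d0 d -> le d0 d' -> c * \sum_(j <- s) u j d d' < e.
Proof.
move=> [[dflt] [lerefl [letrans leub]]] u0 usmall.
have small_sum e : 0 < e -> exists d0, forall d d',
    le d0 d -> le d0 d' -> \sum_(j <- s) u j d d' < e.
  elim: s e => [|j s IH] e e0.
    by exists dflt => d d' _ _; rewrite big_nil.
  have e20 : 0 < e / 2 by lra.
  have [d1 h1] := usmall j _ e20; have [d2 h2] := IH _ e20.
  have [d0 [d10 d20]] := leub d1 d2.
  exists d0 => d d' ld ld'; rewrite big_cons.
  have := h1 d d' (letrans _ _ _ d10 ld) (letrans _ _ _ d10 ld').
  have := h2 d d' (letrans _ _ _ d20 ld) (letrans _ _ _ d20 ld').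
  lra.
(* [c] may be zero or negative, hence the positive bound |c| + 1. *)
move=> e e0; have c0 : 0 < `|c| + 1 by have := normr_ge0 c; lra.
have [d0 h] := small_sum _ (divr_gt0 e0 c0); exists d0 => d d' ld ld'.
have := h _ _ ld ld'; rewrite ltr_pdivlMr // => hs.
apply: le_lt_trans hs; rewrite mulrC; apply: ler_wpM2l; first exact: sumr_ge0.
by have := ler_norm c; lra.
Qed.

(** The limit is the limit inferior of the net, the supremum of the set [E] of its eventual lower
    bounds. A Cauchy threshold [d0] for [e] traps it between [x d0 - e] and [x d0 + e]. *)
Lemma real_net_complete (D : Type) (le : D -> D -> Prop) (x : D -> R) :
  net_directed le ->
  (forall e : R, 0 < e -> exists d0, forall d d',
     le d0 d -> le d0 d' -> `|x d - x d'| < e) ->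
  exists y : R, forall e : R, 0 < e -> exists d0, forall d,
     le d0 d -> `|x d - y| < e.
Proof.
move=> [[dflt] [lerefl [letrans leub]]] xC.
pose E := [set t | exists d0, forall d, le d0 d -> t <= x d].
have lowE e d0 : (forall d d', le d0 d -> le d0 d' -> `|x d - x d'| < e) ->
    E (x d0 - e).
  move=> h; exists d0 => d ld; have := h d d0 ld (lerefl _).
  by rewrite ltr_norml; lra.
have upE e d0 : (forall d d', le d0 d -> le d0 d' -> `|x d - x d'| < e) ->
    ubound E (x d0 + e).
  move=> h t [d1 h1]; have [d [l0 l1]] := leub d0 d1.
  have := h d d0 l0 (lerefl _); have := h1 _ l1.
  by rewrite ltr_norml; lra.
have [d1 h1] := xC _ (@ltr01 R).
have supE : has_sup E.
  by split; [exists (x d1 - 1); apply: lowE|exists (x d1 + 1); apply: upE].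
exists (sup E) => e e0; have e30 : 0 < e / 3 by lra.
have [d0 h0] := xC _ e30; exists d0 => d ld.
have lo := sup_upper_bound supE (lowE _ _ h0).
have hi := ge_sup supE.1 (upE _ _ h0).
have := h0 d d0 ld (lerefl _); rewrite !ltr_norml; lra.
Qed.

Lemma normc_ge_absRe (z : C) : `|complex.Re z| <= Normc.normc z.
Proof.
case: z => a b /=; rewrite -sqrtr_sqr; apply: ler_wsqrtr.
by rewrite lerDl sqr_ge0.
Qed.

Lemma normc_ge_absIm (z : C) : `|complex.Im z| <= Normc.normc z.
Proof.
case: z => a b /=; rewrite -sqrtr_sqr; apply: ler_wsqrtr.
by rewrite lerDr sqr_ge0.
Qed.

Lemma normc_le_ReIm (z : C) :
  Normc.normc z <= `|complex.Re z| + `|complex.Im z|.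
Proof.
case: z => a b /=; rewrite -[leRHS]ger0_norm ?addr_ge0 //.
rewrite -sqrtr_sqr; apply: ler_wsqrtr.
rewrite sqrrD !real_normK ?num_real //.
by have := mulr_ge0 (normr_ge0 a) (normr_ge0 b); lra.
Qed.

Lemma complex_net_complete (D : Type) (le : D -> D -> Prop) (x : D -> C) :
  net_directed le ->
  (forall e : R, 0 < e -> exists d0, forall d d',
     le d0 d -> le d0 d' -> Normc.normc (x d - x d') < e) ->
  exists y : C, forall e : R, 0 < e -> exists d0, forall d,
     le d0 d -> Normc.normc (x d - y) < e.
Proof.
move=> leD xC.
have [e e0|a ha] := @real_net_complete D le (fun d => complex.Re (x d)) leD.
  have [d0 h] := xC e e0; exists d0 => d d' ld ld'.
  apply: le_lt_trans (h _ _ ld ld'); apply: le_trans (normc_ge_absRe _).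
  by case: (x d) (x d') => ? ? [].
have [e e0|b hb] := @real_net_complete D le (fun d => complex.Im (x d)) leD.
  have [d0 h] := xC e e0; exists d0 => d d' ld ld'.
  apply: le_lt_trans (h _ _ ld ld'); apply: le_trans (normc_ge_absIm _).
  by case: (x d) (x d') => ? ? [].
exists (a +i* b)%C => e e0; have e20 : 0 < e / 2 by lra.
have [d1 h1] := ha _ e20; have [d2 h2] := hb _ e20.
have [_ [_ [letrans leub]]] := leD; have [d0 [l1 l2]] := leub d1 d2.
exists d0 => d ld; apply: le_lt_trans (normc_le_ReIm _) _.
have := h1 _ (letrans _ _ _ l1 ld); have := h2 _ (letrans _ _ _ l2 ld).
by case: (x d) => ? ? /=; lra.
Qed.

End Seminorms.

(** * Finite-dimensional subspaces: linear coordinates, the l1 norm and completeness *)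

Section Coordinates.
Variables (R : realType) (V : lmodType R[i]) (S : set V).
Hypothesis S_lin : lin_subspace S.
Local Notation C := R[i].

Definition spanning_family (m : nat) (v : nat -> V) :=
  (forall k, S (v k)) /\
  forall x, S x -> exists a : nat -> C, x = \sum_(k < m) a k *: v k.

(** Indices range over all of [nat], so that [m] can vary with the degree without dependent types;
    only [k < m] enters the expansion. *)
Definition coordinates_on (m : nat) (v : nat -> V) (c : nat -> V -> C) :=
  [/\ forall k, S (v k), forall x, S x -> x = \sum_(k < m) c k x *: v k,
      forall k x y, S x -> S y -> c k (x + y) = c k x + c k y &
      forall k (a : C) x, S x -> c k (a *: x) = a * c k x].

(** Since [a j] is invertible, subtracting [b j / a j] times the relation from an expansion removes
    [v j] from it; [bump j] enumerates the other indices. *)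
Lemma spanning_family_shrink m (v : nat -> V) (a : nat -> C) (j : 'I_m) :
  spanning_family m v -> \sum_(k < m) a k *: v k = 0 -> a j != 0 ->
  exists w, spanning_family m.-1 w.
Proof.
case: m j => [[]//|m] j [Sv span] a0 aj; exists (v \o bump j).
split=> [k|x Sx]; first exact: Sv.
have [b ->] := span _ Sx.
exists (fun k => b (bump j k) - b j / a j * a (bump j k)).
have -> : \sum_(k < m.+1) b k *: v k =
    \sum_(k < m.+1) (b k - b j / a j * a k) *: v k.
  have -> : \sum_(k < m.+1) (b k - b j / a j * a k) *: v k =
      \sum_(k < m.+1) b k *: v k - (b j / a j) *: \sum_(k < m.+1) a k *: v k.
    rewrite scaler_sumr -sumrB; apply: eq_bigr => k _.
    by rewrite scalerBl scalerA.
  by rewrite a0 scaler0 subr0.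
by rewrite (bigD1_ord j) //= divfK // subrr scale0r add0r.
Qed.

(** A spanning family of minimal length is linearly independent, so expansions are unique, and
    uniqueness makes the coefficients linear. *)
Lemma exists_coordinates :
  (exists m v, spanning_family m v) -> exists m v c, coordinates_on m v c.
Proof.
move=> ex_span; pose P m := `[< exists v, spanning_family m v >].
have exP : exists m, P m by have [m h] := ex_span; exists m; apply/asboolP.
case: (ex_minnP exP) => m /asboolP [v [Sv span]] minm.
have free (a : nat -> C) : \sum_(k < m) a k *: v k = 0 ->
    forall k, (k < m)%N -> a k = 0.
  (* A nontrivial relation would leave a spanning family of [m.-1] vectors, against minimality;
     [k < m] excludes [m = 0], where [m.-1 = m]. *)
  move=> a0 k km; apply: contra_notP (@negP (m <= m.-1)%N _); last first.
    by case: (m) km => // n _; rewrite ltnn.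
  move/eqP => ak; apply: minm; apply/asboolP.
  exact: (@spanning_family_shrink _ v a (Ordinal km)).
have /choice [f hf] : forall x, exists a : nat -> C,
    S x -> x = \sum_(k < m) a k *: v k.
  move=> x; have [Sx|nSx] := pselect (S x); last by exists (fun _ => 0).
  by have [a] := span x Sx; exists a.
have uniq_coord (a b : nat -> C) :
    \sum_(k < m) a k *: v k = \sum_(k < m) b k *: v k ->
    forall k, (k < m)%N -> a k = b k.
  move=> ab k km; apply/eqP; rewrite -subr_eq0; apply/eqP.
  apply: (free (fun k => a k - b k)) => //.
  under eq_bigr do rewrite scalerBl.
  by rewrite sumrB ab subrr.
(* The value 0 for [k >= m] makes every [c k] linear on [S], not only the first [m]. *)
exists m, v, (fun k x => if (k < m)%N then f x k else 0); split=> //.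
- move=> x Sx; rewrite {1}(hf x Sx); apply: eq_bigr => k _; by rewrite ltn_ord.
- move=> k x y Sx Sy; case: ifP => [km|_]; last by rewrite addr0.
  apply: (uniq_coord _ (fun k => f x k + f y k)) => //.
  rewrite -hf; last exact: subspaceD.
  under eq_bigr do rewrite scalerDl.
  by rewrite big_split /= -!hf.
- move=> k a x Sx; case: ifP => [km|_]; last by rewrite mulr0.
  apply: (uniq_coord _ (fun k => a * f x k)) => //.
  rewrite -hf; last exact: subspaceZ.
  under eq_bigr do rewrite -scalerA.
  by rewrite -scaler_sumr -hf.
Qed.

Variables (m : nat) (v : nat -> V) (c : nat -> V -> C).
Hypothesis coordP : coordinates_on m v c.

Definition l1norm (x : V) : R := \sum_(k < m) Normc.normc (c k x).

Lemma l1norm_seminorm : seminorm_on S l1norm.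
Proof.
have [Sv _ cD cZ] := coordP; split=> [x y Sx Sy|a x Sx].
  rewrite -big_split /=; apply: ler_sum => k _.
  by rewrite cD //; apply: le_normcD.
rewrite mulr_sumr; apply: eq_bigr => k _.
by rewrite cZ // Normc.normcM.
Qed.

Lemma coord_le_l1norm k x : (k < m)%N -> Normc.normc (c k x) <= l1norm x.
Proof.
move=> km; rewrite /l1norm (bigD1 (Ordinal km)) //= lerDl.
by apply: sumr_ge0 => j _; case: (c j x) => a b; apply: sqrtr_ge0.
Qed.

Lemma l1norm_eq0 x : S x -> l1norm x = 0 -> x = 0.
Proof.
move=> Sx x0; have [_ xE _ _] := coordP; rewrite (xE x Sx); apply: big1 => k _.
suff -> : c k x = 0 by rewrite scale0r.
apply: Normc.eq0_normc; apply/le_anti; rewrite -{1}x0 coord_le_l1norm //=.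
by case: (c k x) => a b; apply: sqrtr_ge0.
Qed.

(** Linearity controls [f] by its values on the spanning vectors; [f] will be left multiplication by
    a homogeneous element. *)
Lemma seminorm_le_coord (W : lmodType C) (f : {linear V -> W}) (T : set W)
    (p : W -> R) x :
  lin_subspace T -> seminorm_on T p -> (forall k, T (f (v k))) ->
  S x -> p (f x) <= \sum_(k < m) Normc.normc (c k x) * p (f (v k)).
Proof.
move=> T_lin p_sn Tfv Sx; have [_ xE _ _] := coordP.
rewrite {1}(xE x Sx) linear_sum.
apply: le_trans (seminorm_sum T_lin p_sn _ _ _) _ => [k|].
  by rewrite linearZ; apply: subspaceZ => //; apply: Tfv.
by apply: ler_sum => k _; rewrite linearZ (seminormZ p_sn) //; apply: Tfv.
Qed.

(** Each coordinate is dominated by [l1norm], hence forms a Cauchy net of complex numbers, and the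
    limits [z k] are the coefficients of [y]. The same [y] serves all seminorms on [S], as is needed
    to find one limit for all members of P. *)
Lemma finite_dim_net_complete (D : Type) (le : D -> D -> Prop) (x : D -> V) :
  net_directed le -> (forall d, S (x d)) ->
  (forall e : R, 0 < e -> exists d0, forall d d',
     le d0 d -> le d0 d' -> l1norm (x d - x d') < e) ->
  exists y, S y /\ forall p, seminorm_on S p -> forall e : R, 0 < e ->
    exists d0, forall d, le d0 d -> p (x d - y) < e.
Proof.
move=> leD Sx xC; have [Sv xE cD cZ] := coordP.
have /choice [z hz] : forall k : 'I_m, exists z : C, forall e : R, 0 < e ->
    exists d0, forall d, le d0 d -> Normc.normc (c k (x d) - z) < e.
  move=> k; apply: complex_net_complete => // e e0.
  have [d0 h] := xC e e0; exists d0 => d d' ld ld'.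
  apply: le_lt_trans (h _ _ ld ld').
  have -> : c k (x d) - c k (x d') = c k (x d - x d').
    by rewrite cD //; [rewrite -scaleN1r cZ // mulN1r|apply: subspaceN].
  exact: coord_le_l1norm.
exists (\sum_(k < m) z k *: v k); split.
  by apply: subspace_sum => // k; apply: subspaceZ.
(* [M] bounds each [p (v k)], so [p (x d - y)] is at most [M] times the sum of the coordinate
   errors. *)
move=> p p_sn e e0; pose M := \sum_(k < m) p (v k).
have [||d0 h] := @directed_small R D 'I_m le
  (fun k d _ => Normc.normc (c k (x d) - z k)) (index_enum _) M leD _ _ e e0.
- by move=> k d _; case: (_ - _) => a b; apply: sqrtr_ge0.
- by move=> k e' e'0; have [d0 h] := hz k e' e'0; exists d0 => d d' ld _; apply: h.
exists d0 => d ld; apply: le_lt_trans (h _ _ ld ld).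
rewrite {1}(xE (x d)) // -sumrB mulr_sumr.
apply: le_trans (seminorm_sum S_lin p_sn _ _ _) _ => [k|].
  by apply: subspaceB => //; apply: subspaceZ.
apply: ler_sum => k _; rewrite -scalerBl (seminormZ p_sn) // mulrC.
apply: ler_wpM2r; first by case: (_ - _) => a b; apply: sqrtr_ge0.
rewrite /M (bigD1 k) //= lerDl; apply: sumr_ge0 => j _.
exact: (seminorm_ge0 S_lin p_sn).
Qed.

End Coordinates.

(** * Series with nonnegative real terms *)

Lemma nneseries_le (R : realType) (u : nat -> R) (M : R) :
  (forall n, 0 <= u n) -> (forall N, \sum_(n < N) u n <= M) ->
  (\sum_(n <oo) (u n)%:E <= M%:E)%E.
Proof.
move=> u0 uM; apply: lime_le.
  by apply: is_cvg_nneseries => n _ _; rewrite lee_fin.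
by apply: nearW => N; rewrite sumEFin lee_fin big_mkord.
Qed.

Lemma partial_sum_le_nneseries (R : realType) (u : nat -> R) (N : nat) :
  (forall n, 0 <= u n) -> (\sum_(n <oo) (u n)%:E < +oo)%E ->
  \sum_(n < N) u n <= fine (\sum_(n <oo) (u n)%:E)%E.
Proof.
move=> u0 ufin; rewrite -lee_fin fineK; last first.
  by rewrite ge0_fin_numE //; apply: nneseries_ge0 => n _ _; rewrite lee_fin.
rewrite -sumEFin -(big_mkord xpredT (fun n => (u n)%:E)).
by apply: nneseries_lim_ge => n _ _; rewrite lee_fin.
Qed.

(** * Homogeneous components and the embedding of the algebra into sequences *)

Section Graded.
Variables (R : realType) (A : algType R[i]) (Agr : nat -> set A).
Local Notation C := R[i].
Hypothesis gr : graded_algebra Agr.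

Lemma graded_lin n : lin_subspace (Agr n).
Proof. by case: gr. Qed.

Lemma graded_mul i j a b : Agr i a -> Agr j b -> Agr (i + j)%N (a * b).
Proof. by case: gr => _ [_ [_]]; apply. Qed.

Lemma graded_indep (N : nat) (f : nat -> A) : (forall n, Agr n (f n)) ->
  \sum_(n < N) f n = 0 -> forall n, (n < N)%N -> f n = 0.
Proof. by case: gr => _ [_ [+ _]]; apply. Qed.

Lemma sum_eventually0 (f : nat -> A) (N K : nat) :
  (forall n, (N <= n)%N -> f n = 0) -> (N <= K)%N ->
  \sum_(n < K) f n = \sum_(n < N) f n.
Proof.
move=> f0 NK; rewrite -!(big_mkord xpredT f) (big_cat_nat (n := N)) //=.
rewrite [X in _ + X]big_nat_cond [X in _ + X]big1 ?addr0 // => i.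
by rewrite andbT => /andP[Ni _]; apply: f0.
Qed.

Lemma decomposition_uniq a f g :
  is_decomposition Agr a f -> is_decomposition Agr a g -> f = g.
Proof.
move=> [Af [N [f0 aE]]] [Ag [M [g0 aE']]]; apply/funext => n.
have [nNM|NMn] := ltnP n (maxn N M); last first.
  by rewrite f0 ?g0 //; move: NMn; rewrite geq_max => /andP[].
apply/eqP; rewrite -subr_eq0; apply/eqP.
apply: (@graded_indep (maxn N M) (fun k => f k - g k)) => // [k|].
  exact: (subspaceB (graded_lin k)).
rewrite sumrB (@sum_eventually0 f N) ?leq_maxl //.
by rewrite (@sum_eventually0 g M) ?leq_maxr // -aE -aE' subrr.
Qed.

Lemma components_decomposition a : is_decomposition Agr a (components Agr a).
Proof.
apply: ClassicalEpsilon.epsilon_spec; have [_ [+ _]] := gr.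
(* The family given by [graded_algebra] may be nonzero from [N] on, while [is_decomposition] wants
   zeros there, so it is cut off. *)
move=> /(_ a) [N [f [Af ->]]]; exists (fun n => if (n < N)%N then f n else 0).
split=> [n|]; first by case: ifP => // _; apply: (subspace0 (graded_lin n)).
exists N; split=> [n Nn|]; first by rewrite ltnNge Nn.
by apply: eq_bigr => i _; rewrite ltn_ord.
Qed.

(** Reduces identities about [iotaA] to exhibiting a single decomposition. *)
Lemma iotaA_eq a f : is_decomposition Agr a f -> iotaA Agr a = f.
Proof. exact: decomposition_uniq (components_decomposition a). Qed.

Definition truncate (M : nat) (x : nat -> A) : nat -> A :=
  fun n => if (n < M)%N then x n else 0.

Lemma iotaA_sum (M : nat) x : in_prod Agr x ->
  iotaA Agr (\sum_(n < M) x n) = truncate M x.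
Proof.
move=> Ax; apply: iotaA_eq; rewrite /truncate; split=> [n|].
  by case: ifP => // _; apply: (subspace0 (graded_lin n)).
exists M; split=> [n Mn|]; first by rewrite ltnNge Mn.
by apply: eq_bigr => i _; rewrite ltn_ord.
Qed.

Lemma decomposition_homog m a :
  Agr m a -> is_decomposition Agr a (fun k => if k == m then a else 0).
Proof.
move=> Aa; split=> [n|].
  by case: eqP => [->//|_]; apply: (subspace0 (graded_lin n)).
exists m.+1; split=> [n mn|]; first by rewrite gtn_eqF.
rewrite big_ord_recr /= eqxx big1 ?add0r // => i _.
by rewrite ltn_eqF.
Qed.

Lemma seq_mul_in_prod x y :
  in_prod Agr x -> in_prod Agr y -> in_prod Agr (seq_mul x y).
Proof.
move=> Ax Ay k; rewrite /seq_mul; apply: big_ind => [|u w|i _].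
- exact: (subspace0 (graded_lin k)).
- exact: (subspaceD (graded_lin k)).
- by have := graded_mul (Ax i) (Ay (k - i)%N); rewrite subnKC // -ltnS.
Qed.

Lemma decomposition_mul a b f g :
  is_decomposition Agr a f -> is_decomposition Agr b g ->
  is_decomposition Agr (a * b) (seq_mul f g).
Proof.
move=> [Af [N [f0 aE]]] [Ag [M [g0 bE]]].
split; first exact: seq_mul_in_prod.
(* In degrees [n >= N + M], either [i >= N] or [n - i >= M], so every summand has a zero factor. *)
exists (N + M)%N; split=> [n NMn|].
  rewrite /seq_mul big1 // => i _; have [iN|Ni] := ltnP i N.
    by rewrite g0 ?mulr0 //; lia.
  by rewrite f0 ?mul0r.
(* For [i < N] the inner sum has length [N + M - i >= M], so it is all of [b]. *)
rewrite cauchy_product_sum aE mulr_suml.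
rewrite (@sum_eventually0 (fun i => f i * \sum_(j < N + M - i) g j) N) ?leq_addr //;
  last first.
  by move=> n Nn; rewrite f0 ?mul0r.
apply: eq_bigr => i _; rewrite (@sum_eventually0 g M) ?bE //.
by have := ltn_ord i; lia.
Qed.

(** [graded_algebra] does not place the unit in degree 0. If [e] denotes its components, the degree
    [m] part of [1 * a = a] reads [e 0 * a = a] for [a] of degree [m]; applied to every component of
    1, this gives [e 0 = e 0 * 1 = 1]. *)
Lemma graded_one : Agr 0 1.
Proof.
have [Ae [N [e0 e1]]] := components_decomposition 1.
move: (components Agr 1) Ae e0 e1 => e Ae e0 e1.
have e0_id m a : Agr m a -> e 0%N * a = a.
  move=> Aa; have da := decomposition_homog Aa.
  have d1 : is_decomposition Agr 1 e by split=> //; exists N.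
  have := decomposition_mul d1 da; rewrite mul1r => /decomposition_uniq/(_ da).
  move=> /(congr1 (fun f => f m)); rewrite /seq_mul eqxx big_ord_recl /=.
  rewrite subn0 eqxx big1 ?addr0 // => i _.
  by rewrite ltn_eqF ?mulr0 // /bump /=; have := ltn_ord i; lia.
have e0_one : e 0%N = 1.
  rewrite -[LHS]mulr1 {1}e1 mulr_sumr [RHS]e1; apply: eq_bigr => i _.
  exact: e0_id (Ae i).
by rewrite -e0_one.
Qed.

Lemma iotaA_hom : hom_on setT *%R 1 (@seq_mul R A) (seq_one A) (iotaA Agr).
Proof.
split; last split; last split.
- move=> x y _ _; apply: iotaA_eq.
  have [Af [N [f0 xE]]] := components_decomposition x.
  have [Ag [M [g0 yE]]] := components_decomposition y.
  split=> [n|]; first exact: (subspaceD (graded_lin n) (Af n) (Ag n)).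
  exists (maxn N M); split=> [n|].
    by rewrite geq_max /= => /andP[Nn Mn]; rewrite /iotaA !fctE f0 ?g0 ?addr0.
  rewrite big_split /= (@sum_eventually0 (components Agr x) N) ?leq_maxl //.
  by rewrite (@sum_eventually0 (components Agr y) M) ?leq_maxr // -xE -yE.
- move=> c x _; apply: iotaA_eq.
  have [Af [N [f0 xE]]] := components_decomposition x.
  split=> [n|]; first exact: (subspaceZ (graded_lin n) c (Af n)).
  exists N; split=> [n Nn|]; first by rewrite /iotaA !fctE f0 ?scaler0.
  by rewrite {1}xE scaler_sumr.
- move=> x y _ _; apply/iotaA_eq/decomposition_mul;
    exact: components_decomposition.
- by rewrite (iotaA_eq (decomposition_homog graded_one)).
Qed.

Lemma in_prod_lin : lin_subspace (in_prod Agr).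
Proof.
split=> [n|]; first exact: (subspace0 (graded_lin n)).
split=> [x y Ax Ay n|c x Ax n]; first exact: (subspaceD (graded_lin n)).
exact: (subspaceZ (graded_lin n)).
Qed.

(** * The seminorms [lnorm p] and the subalgebra on which all of them are finite *)

Section Lnorm.
Variable p : Pidx Agr.
Local Notation pn := (proj1_sig p).

Lemma graded_seminorm n : seminorm_on (Agr n) (pn n).
Proof. by case: (proj2_sig p). Qed.

Lemma graded_seminorm_mul i j a b :
  Agr i a -> Agr j b -> pn (i + j)%N (a * b) <= pn i a * pn j b.
Proof. by case: (proj2_sig p) => _; apply. Qed.

Lemma graded_seminorm_ge0 n a : Agr n a -> 0 <= pn n a.
Proof. exact: (seminorm_ge0 (graded_lin n) (graded_seminorm n)). Qed.

Lemma lnorm_lty x (M : R) : in_prod Agr x ->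
  (forall N, \sum_(n < N) pn n (x n) <= M) -> (lnorm_e pn x < +oo)%E.
Proof.
move=> Ax xM; apply: (@le_lt_trans _ _ M%:E); last by rewrite ltry.
by apply: nneseries_le => // n; apply: graded_seminorm_ge0.
Qed.

(** Together with [lnorm_lty] and [partial_sum_le_lnorm], this trades extended real series for
    finite partial sums in the later estimates. *)
Lemma lnorm_le x (M : R) : in_prod Agr x ->
  (forall N, \sum_(n < N) pn n (x n) <= M) -> lnorm p x <= M.
Proof.
move=> Ax xM; have x0 n : 0 <= pn n (x n) by apply: graded_seminorm_ge0.
(* [fine] sends infinite values to 0, so finiteness has to come before the comparison. *)
have fin := lnorm_lty Ax xM.
rewrite -lee_fin fineK; first exact: nneseries_le.
by rewrite ge0_fin_numE //; apply: nneseries_ge0 => n _ _; rewrite lee_fin.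
Qed.

Lemma partial_sum_le_lnorm x N : lambdaPA Agr x ->
  \sum_(n < N) pn n (x n) <= lnorm p x.
Proof.
move=> [Ax fin].
apply: (@partial_sum_le_nneseries R (fun n => pn n (x n))) => [n|].
  exact: graded_seminorm_ge0.
exact: fin.
Qed.

Lemma lnorm_ge0 x : lambdaPA Agr x -> 0 <= lnorm p x.
Proof. by move=> /(partial_sum_le_lnorm 0); rewrite big_ord0. Qed.

Lemma le_lnorm x n : lambdaPA Agr x -> pn n (x n) <= lnorm p x.
Proof.
move=> Lx; apply: le_trans (partial_sum_le_lnorm n.+1 Lx).
rewrite big_ord_recr /= lerDr; apply: sumr_ge0 => i _.
by apply: graded_seminorm_ge0; case: Lx.
Qed.

Lemma partial_sumD x y N : in_prod Agr x -> in_prod Agr y ->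
  \sum_(n < N) pn n ((x + y) n) <=
  \sum_(n < N) pn n (x n) + \sum_(n < N) pn n (y n).
Proof.
move=> Ax Ay; rewrite -big_split /=; apply: ler_sum => n _.
exact: (seminormD (graded_seminorm n)).
Qed.

Lemma partial_sumZ (c : C) x N : in_prod Agr x ->
  \sum_(n < N) pn n ((c *: x) n) = Normc.normc c * \sum_(n < N) pn n (x n).
Proof.
move=> Ax; rewrite mulr_sumr; apply: eq_bigr => n _.
exact: (seminormZ (graded_seminorm n)).
Qed.

(** Graded submultiplicativity bounds the degree [k] part by the Cauchy product of [pn n (x n)] and
    [pn n (y n)]; [le_cauchy_product] then separates the factors. *)
Lemma partial_sum_mul x y N : lambdaPA Agr x -> lambdaPA Agr y ->
  \sum_(n < N) pn n (seq_mul x y n) <= lnorm p x * lnorm p y.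
Proof.
move=> Lx Ly; have [[Ax _] [Ay _]] := (Lx, Ly).
have x0 n : 0 <= pn n (x n) by apply: graded_seminorm_ge0.
have y0 n : 0 <= pn n (y n) by apply: graded_seminorm_ge0.
apply: (@le_trans _ _ ((\sum_(n < N) pn n (x n)) * (\sum_(n < N) pn n (y n)))).
  apply: le_trans (le_cauchy_product N x0 y0); apply: ler_sum => k _.
  have Axy (i : 'I_k.+1) : Agr k (x i * y (k - i)%N).
    by have := graded_mul (Ax i) (Ay (k - i)%N); rewrite subnKC // -ltnS.
  apply: le_trans (seminorm_sum (graded_lin k) (graded_seminorm k) _ _ Axy) _.
  apply: ler_sum => i _.
  by have := graded_seminorm_mul (Ax i) (Ay (k - i)%N); rewrite subnKC // -ltnS.
by apply: ler_pM; rewrite ?partial_sum_le_lnorm //; apply: sumr_ge0.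
Qed.

End Lnorm.

Lemma lambdaPA_lin : lin_subspace (lambdaPA Agr).
Proof.
have prod_lin := in_prod_lin; split; [|split].
- split=> [|p]; first exact: (subspace0 prod_lin).
  apply: (@lnorm_lty p 0 0) => [|N]; first exact: (subspace0 prod_lin).
  rewrite big1 // => n _.
  exact: (seminorm0 (graded_lin n) (graded_seminorm p n)).
- move=> x y Lx Ly; have [[Ax _] [Ay _]] := (Lx, Ly).
  split=> [|p]; first exact: (subspaceD prod_lin).
  apply: (@lnorm_lty p _ (lnorm p x + lnorm p y)) => [|N].
    exact: (subspaceD prod_lin).
  apply: le_trans (partial_sumD _ _ Ax Ay) _.
  by apply: lerD; apply: partial_sum_le_lnorm.
- move=> c x Lx; have [Ax _] := Lx; split=> [|p]; first exact: (subspaceZ prod_lin).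
  apply: (@lnorm_lty p _ (Normc.normc c * lnorm p x)) => [|N].
    exact: (subspaceZ prod_lin).
  rewrite partial_sumZ //; apply: ler_wpM2l; last exact: partial_sum_le_lnorm.
  by case: (c) => a b; apply: sqrtr_ge0.
Qed.

Lemma lnorm_seminorm p : seminorm_on (lambdaPA Agr) (@lnorm R A Agr p).
Proof.
have prod_lin := in_prod_lin; split=> [x y Lx Ly|c x Lx].
  have [[Ax _] [Ay _]] := (Lx, Ly).
  apply: (@lnorm_le p _ (lnorm p x + lnorm p y)) => [|N].
    exact: (subspaceD prod_lin).
  apply: le_trans (partial_sumD _ _ Ax Ay) _.
  by apply: lerD; apply: partial_sum_le_lnorm.
have [Ax _] := Lx.
(* Bounding partial sums yields one inequality; the reverse one is the same inequality applied to
   [c^-1] and [c *: x]. *)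
have le_scale (a : C) y : lambdaPA Agr y ->
    lnorm p (a *: y) <= Normc.normc a * lnorm p y.
  move=> Ly; have [Ay _] := Ly.
  apply: (@lnorm_le p _ _) => [|N]; first exact: (subspaceZ prod_lin).
  rewrite partial_sumZ //; apply: ler_wpM2l; last exact: partial_sum_le_lnorm.
  by case: (a) => u w; apply: sqrtr_ge0.
have Lcx : lambdaPA Agr (c *: x) by apply: (subspaceZ lambdaPA_lin).
apply/le_anti; rewrite le_scale //=; have [->|c0] := eqVneq c 0.
  by rewrite scale0r Normc.normc0 mul0r lnorm_ge0 //; apply: (subspace0 lambdaPA_lin).
have nc0 : Normc.normc c != 0 by apply: contra_neq c0 => /Normc.eq0_normc.
have := le_scale c^-1 _ Lcx; rewrite scalerA mulVf // scale1r Normc.normcV.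
have nc_gt0 : 0 < Normc.normc c.
  by rewrite lt0r nc0; case: (c) => u w; apply: sqrtr_ge0.
by rewrite ler_pdivlMl.
Qed.

Lemma lnorm_submult p :
  submult_on (lambdaPA Agr) (@seq_mul R A) (@lnorm R A Agr p).
Proof.
move=> x y Lx Ly; apply: (@lnorm_le p _ _) => [|N].
  by apply: seq_mul_in_prod; [case: Lx|case: Ly].
exact: partial_sum_mul.
Qed.

Lemma finite_support_lambdaPA x M : in_prod Agr x ->
  (forall n, (M <= n)%N -> x n = 0) ->
  lambdaPA Agr x.
Proof.
move=> Ax x0; have bound (p : Pidx Agr) N :
    \sum_(n < N) proj1_sig p n (x n) <= \sum_(n < M) proj1_sig p n (x n).
  have px0 n : 0 <= proj1_sig p n (x n) by apply: graded_seminorm_ge0.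
  have [NM|MN] := leqP N M; first exact: ler_sum_prefix px0 NM.
  rewrite -!(big_mkord xpredT (fun n => proj1_sig p n (x n))).
  rewrite (big_cat_nat (n := M)) //= ?(ltnW MN) // gerDl.
  rewrite big_nat_cond big1 // => i; rewrite andbT => /andP[Mi _].
  by rewrite x0 //; apply: (seminorm0 (graded_lin i) (graded_seminorm p i)).
by split=> // p; apply: lnorm_lty Ax (bound p).
Qed.

Lemma iotaA_lambdaPA a : lambdaPA Agr (iotaA Agr a).
Proof.
have [Af [N [f0 _]]] := components_decomposition a.
exact: finite_support_lambdaPA Af f0.
Qed.

Lemma lambdaPA_alg : alg_closed_on (lambdaPA Agr) (@seq_mul R A) (seq_one A).
Proof.
split; first exact: lambdaPA_lin; split=> [|x y Lx Ly].
  have [_ [_ [_ <-]]] := iotaA_hom; exact: iotaA_lambdaPA.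
have Axy : in_prod Agr (seq_mul x y).
  by apply: seq_mul_in_prod; [case: Lx|case: Ly].
by split=> // p; apply: (lnorm_lty Axy (fun N => partial_sum_mul p N Lx Ly)).
Qed.

End Graded.

(** * Hausdorffness and completeness from local finiteness *)

Section LocallyFinite.
Variables (R : realType) (A : algType R[i]) (Agr : nat -> set A).
Local Notation C := R[i].
Hypothesis gr : graded_algebra Agr.

Lemma locally_finite_coordinates : locally_finite Agr ->
  exists (m : nat -> nat) (v : nat -> nat -> A) (c : nat -> nat -> A -> C),
    forall n, coordinates_on (Agr n) (m n) (v n) (c n).
Proof.
move=> lf.
have /choice [f hf] : forall n, exists mvc : nat * (nat -> A) * (nat -> A -> C),
    coordinates_on (Agr n) mvc.1.1 mvc.1.2 mvc.2.
  move=> n; have [s [sA span]] := lf n.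
  have [|m [v [c h]]] := exists_coordinates (graded_lin gr n); last first.
    by exists (m, v, c).
  exists (size s), (fun k => s`_k); split=> [k|]; last exact: span.
  (* Past the end of [s] the default value 0 is returned, which also lies in [Agr n]. *)
  have [ks|sk] := ltnP k (size s); first by apply/sA/mem_nth.
  by rewrite nth_default //; apply: (subspace0 (graded_lin gr n)).
by exists (fun n => (f n).1.1), (fun n => (f n).1.2), (fun n => (f n).2).
Qed.

Variables (m : nat -> nat) (v : nat -> nat -> A) (c : nat -> nat -> A -> C).
Hypothesis coordP : forall n, coordinates_on (Agr n) (m n) (v n) (c n).

Local Notation nrm n := (l1norm (m n) (c n)).

(* An l1 operator norm of left multiplication by [a] on the truncated algebra
   [A / \bigoplus_(n > N) A^n]. *)
Definition truncated_opnorm (N i : nat) (a : A) : R :=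
  if (i <= N)%N then
    \sum_(k < (N - i).+1) \sum_(l < m k) nrm (i + k)%N (a * v k l)
  else 0.

Lemma basis_graded n k : Agr n (v n k).
Proof. by have [+ _ _ _] := coordP n; apply. Qed.

Lemma nrm_seminorm n : seminorm_on (Agr n) (nrm n).
Proof. exact: l1norm_seminorm (coordP n). Qed.

Lemma nrm_ge0 n a : Agr n a -> 0 <= nrm n a.
Proof. exact: (seminorm_ge0 (graded_lin gr n) (nrm_seminorm n)). Qed.

Lemma basis_mul i k l a : Agr i a -> Agr (i + k)%N (a * v k l).
Proof. by move=> Aa; apply: (graded_mul gr) => //; apply: basis_graded. Qed.

Lemma nrm_mul_basis_ge0 i k l a : Agr i a -> 0 <= nrm (i + k)%N (a * v k l).
Proof. by move=> Aa; apply/nrm_ge0/basis_mul. Qed.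

Lemma truncated_opnorm_ge0 N i a : Agr i a -> 0 <= truncated_opnorm N i a.
Proof.
move=> Aa; rewrite /truncated_opnorm; case: ifP => // _.
by do 2 (apply: sumr_ge0 => ? _); apply: nrm_mul_basis_ge0.
Qed.

(** After expanding [x] in the [v k l], each [nrm (i + k) (a * v k l)] is one nonnegative term of
    the double sum [truncated_opnorm N i a]; [i + k <= N] ensures that degree [k] occurs in it. *)
Lemma nrm_mul_le N i k a x : Agr i a -> Agr k x -> (i + k <= N)%N ->
  nrm (i + k)%N (a * x) <= truncated_opnorm N i a * nrm k x.
Proof.
move=> Aa Ax ikN; pose f : {linear A -> A} := GRing.mull_fun a idfun.
apply: le_trans (@seminorm_le_coord _ _ _ _ _ _ (coordP k) A f _ _ x
  (graded_lin gr (i + k)) (nrm_seminorm (i + k)) _ Ax) _ => [l|].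
  exact: basis_mul.
rewrite mulr_sumr; apply: ler_sum => l _; rewrite mulrC.
apply: ler_wpM2r; first by case: (c _ _ _) => u w; apply: sqrtr_ge0.
have kN : (k < (N - i).+1)%N by lia.
rewrite /truncated_opnorm (_ : (i <= N)%N); last by lia.
rewrite (bigD1 (Ordinal kN)) //= (bigD1 l) //= -addrA lerDl.
apply: addr_ge0; first by apply: sumr_ge0 => ? _; apply: nrm_mul_basis_ge0.
by do 2 (apply: sumr_ge0 => ? _); apply: nrm_mul_basis_ge0.
Qed.

(** In [a * (b * v k l)] the right factor has degree [j + k], so [nrm_mul_le] extracts
    [truncated_opnorm N i a]. What remains is a sum over [k <= N - (i + j)], a prefix of the one
    defining [truncated_opnorm N j b]. For [i + j > N] the left side is 0. *)
Lemma truncated_opnorm_graded_submult N :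
  graded_submult_seminorm Agr (truncated_opnorm N).
Proof.
split=> [i|i j a b Aa Ab].
  rewrite /truncated_opnorm; case: (leqP i N) => iN; last first.
    by split=> [x y _ _|s x _]; rewrite ?addr0 ?mulr0.
  split=> [x y Ax Ay|s x Ax].
    rewrite -big_split /=; apply: ler_sum => k _.
    rewrite -big_split /=; apply: ler_sum => l _; rewrite mulrDl.
    by apply: (seminormD (nrm_seminorm _)); apply: basis_mul.
  rewrite mulr_sumr; apply: eq_bigr => k _.
  rewrite mulr_sumr; apply: eq_bigr => l _; rewrite -scalerAl.
  by apply: (seminormZ (nrm_seminorm _)); apply: basis_mul.
rewrite {1}/truncated_opnorm; case: ifP => ijN; last first.
  by apply: mulr_ge0; apply: truncated_opnorm_ge0.
pose w k := \sum_(l < m k) nrm (j + k)%N (b * v k l).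
have w0 k : 0 <= w k by apply: sumr_ge0 => l _; apply: nrm_mul_basis_ge0.
apply: (@le_trans _ _ (truncated_opnorm N i a * \sum_(k < (N - (i + j)).+1) w k)).
  rewrite mulr_sumr; apply: ler_sum => k _.
  rewrite mulr_sumr; apply: ler_sum => l _; rewrite -addnA -mulrA.
  apply: nrm_mul_le => //; first by apply: basis_mul.
  by have := ltn_ord k; lia.
apply: ler_wpM2l; first exact: truncated_opnorm_ge0.
rewrite /truncated_opnorm (_ : (j <= N)%N); last by lia.
by apply: ler_sum_prefix => //; lia.
Qed.

(** Left multiplication by [a] is evaluated at the unit, which has degree 0. *)
Lemma nrm_le_truncated_opnorm n a : Agr n a ->
  nrm n a <= truncated_opnorm n n a * nrm 0%N 1.
Proof.
move=> Aa; have A1 := graded_one gr.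
by have := @nrm_mul_le n n 0 a 1 Aa A1; rewrite addn0 mulr1; apply.
Qed.

(** Projection to degree [n] is thus continuous, which yields both separation and degreewise Cauchy
    nets. *)
Lemma nrm_le_lnorm n : exists (p : Pidx Agr) (K : R),
  0 <= K /\ forall x, lambdaPA Agr x -> nrm n (x n) <= K * lnorm p x.
Proof.
exists (exist _ _ (truncated_opnorm_graded_submult n)), (nrm 0%N 1).
have K0 := nrm_ge0 (graded_one gr).
split=> // x Lx; apply: le_trans (nrm_le_truncated_opnorm (Lx.1 n)) _.
by rewrite mulrC; apply: ler_wpM2l => //; apply: (le_lnorm gr (exist _ _ _)).
Qed.

Lemma lnorm_hausdorff : sn_hausdorff (lambdaPA Agr) (@lnorm R A Agr).
Proof.
move=> x Lx x0; apply/funext => n.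
have [p [K [_ /(_ x Lx)]]] := nrm_le_lnorm n; rewrite x0 mulr0 => nx.
apply: (l1norm_eq0 (coordP n)); first by case: Lx.
by apply/le_anti; rewrite nx nrm_ge0 //; case: Lx.
Qed.

Lemma lnorm_complete : sn_complete (lambdaPA Agr) (@lnorm R A Agr).
Proof.
move=> D le x leD Lx xC; have [[dflt] [lerefl [letrans leub]]] := leD.
have L_lin := lambdaPA_lin gr.
have /choice [y hy] : forall n, exists yn, Agr n yn /\
    forall p, seminorm_on (Agr n) p -> forall e : R, 0 < e ->
      exists d0, forall d, le d0 d -> p (x d n - yn) < e.
  move=> n; apply: (finite_dim_net_complete (graded_lin gr n) (coordP n) leD).
    by move=> d; case: (Lx d).
  move=> e e0; have [p [K [K0 hK]]] := nrm_le_lnorm n.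
  (* [K] may be 0, so the division is by [K + 1]. *)
  have K10 : 0 < K + 1 by lra.
  have [d0 h] := xC p _ (divr_gt0 e0 K10); exists d0 => d d' ld ld'.
  have := h _ _ ld ld'; rewrite ltr_pdivlMr //; apply: le_lt_trans.
  have Lxx := subspaceB L_lin (Lx d) (Lx d').
  apply: le_trans (hK _ Lxx) _; rewrite mulrC; apply: ler_wpM2l; last by lra.
  exact: (lnorm_ge0 gr).
have Ay : in_prod Agr y by move=> n; case: (hy n).
have Axy d : in_prod Agr (x d - y).
  by apply: (subspaceB (in_prod_lin gr)) => //; case: (Lx d).
(* The threshold [d0] must not depend on [N]. For fixed [N], an auxiliary [d'] beyond [d0] is taken
   so far that its first [N] components are within [eta] of [y]; then [eta] tends to 0. *)
have tail (p : Pidx Agr) (e : R) : 0 < e -> exists d0, forall d, le d0 d ->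
    forall N, \sum_(n < N) proj1_sig p n ((x d - y) n) <= e.
  move=> e0; have [d0 h] := xC p _ e0; exists d0 => d ld N.
  apply/ler_addgt0Pr => eta eta0.
  have [||d1 h1] := @directed_small R D 'I_N le
    (fun n d' _ => proj1_sig p n (x d' n - y n)) (index_enum _) 1 leD _ _ eta eta0.
  - by move=> n d' _; apply: (graded_seminorm_ge0 gr); apply: Axy.
  - move=> n e' e'0; have [_ hyn] := hy n.
    have [d1 h1] := hyn _ (graded_seminorm p n) _ e'0.
    by exists d1 => d' d'' l _; apply: h1.
  have [d' [l0 l1]] := leub d0 d1.
  have Lxx := subspaceB L_lin (Lx d) (Lx d').
  have := partial_sum_le_lnorm gr p N Lxx; have := h _ _ ld l0.
  have := h1 _ _ l1 l1; rewrite mul1r => s1 s2 s3.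
  have -> : x d - y = (x d - x d') + (x d' - y).
    by rewrite addrA subrK.
  apply: le_trans (partial_sumD p N _ (Axy d')) _; first by case: Lxx.
  by apply: lerD; [apply: le_trans s3 (ltW s2)|apply: ltW].
have Ly : lambdaPA Agr y.
  split=> // p; have [d0 h] := tail p 1 ltr01.
  (* [y] differs from a member of the net by a sequence whose partial sums are bounded by 1. *)
  have yE : y = x d0 + (-1) *: (x d0 - y) by rewrite scaleN1r opprB addrC subrK.
  rewrite yE; apply: (@lnorm_lty _ _ _ gr p _ (lnorm p (x d0) + 1)).
    by rewrite -yE.
  move=> N; apply: le_trans (partial_sumD p N _ _) _.
  - by case: (Lx d0).
  - by apply: (subspaceZ (in_prod_lin gr)); apply: Axy.
  - rewrite partial_sumZ // normcN Normc.normc1 mul1r.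
    by apply: lerD; [apply: (partial_sum_le_lnorm gr)|apply: h].
exists y; split=> // p e e0; have e20 : 0 < e / 2 by lra.
have [d0 h] := tail p _ e20; exists d0 => d ld.
apply: (@le_lt_trans _ _ (e / 2)); last by lra.
exact: (lnorm_le gr (Axy d) (h d ld)).
Qed.

End LocallyFinite.

(** * Generalities on continuity, directed sets and homomorphisms *)

Lemma sn_continuous_id (R : realType) (V : lmodType R[i]) (S : set V) (I : Type)
  (q : I -> V -> R) : sn_continuous S q q id.
Proof. by move=> i; exists [:: i], 1 => x _; rewrite big_seq1 mul1r. Qed.

Lemma net_directed_nat : net_directed (fun M N : nat => (M <= N)%N).
Proof.
split; first by exists; exact: 0%N.
split=> //; split=> [a b c|a b]; first exact: leq_trans.
by exists (maxn a b); rewrite leq_maxl leq_maxr.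
Qed.

Lemma hom_onB (R : realType) (V W : lmodType R[i]) (S : set V) mulV oneV mulW oneW
    (f : V -> W) x y :
  lin_subspace S -> hom_on S mulV oneV mulW oneW f -> S x -> S y ->
  f (x - y) = f x - f y.
Proof.
move=> S_lin [fD [fZ _]] Sx Sy.
by rewrite -[- y]scaleN1r fD ?fZ ?scaleN1r //; apply: (subspaceN S_lin).
Qed.

Lemma hom_on0 (R : realType) (V W : lmodType R[i]) (S : set V) mulV oneV mulW oneW
    (f : V -> W) :
  lin_subspace S -> hom_on S mulV oneV mulW oneW f -> f 0 = 0.
Proof.
move=> S_lin [_ [fZ _]].
by rewrite -(scale0r (0 : V)) fZ ?scale0r //; apply: (subspace0 S_lin).
Qed.

(** * Density of the image of [A] and the universal property *)

Section Universal.
Variables (R : realType) (A : algType R[i]) (Agr : nat -> set A).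
Local Notation C := R[i].
Hypothesis gr : graded_algebra Agr.
Local Notation L := (lambdaPA Agr).
Local Notation iota := (iotaA Agr).

Let L_lin : lin_subspace L := lambdaPA_lin gr.
Let Liota := iotaA_lambdaPA gr.

Lemma truncate_small x (p : Pidx Agr) (e : R) : L x -> 0 < e ->
  exists N0, forall N, (N0 <= N)%N -> lnorm p (x - truncate N x) <= e.
Proof.
move=> Lx e0; have [Ax _] := Lx.
have px0 n : 0 <= proj1_sig p n (x n) by apply: (graded_seminorm_ge0 gr).
(* Otherwise [lnorm p x - e] would bound all partial sums, hence [lnorm p x] itself. *)
have [N0 hN0] : exists N0, lnorm p x - e < \sum_(n < N0) proj1_sig p n (x n).
  apply: contrapT => /forallNP h.
  suff : lnorm p x <= lnorm p x - e by lra.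
  by apply: (lnorm_le gr Ax) => N; rewrite leNgt; apply/negP.
exists N0 => N N0N.
have xT n : (x - truncate N x) n = if (n < N)%N then 0 else x n.
  by rewrite /truncate !fctE; case: ifP; rewrite ?subrr ?subr0.
have AxT : in_prod Agr (x - truncate N x).
  by move=> n; rewrite xT; case: ifP => // _; apply: (subspace0 (graded_lin gr n)).
apply: (lnorm_le gr AxT) => M.
have pT0 n : 0 <= proj1_sig p n ((x - truncate N x) n).
  by apply: (graded_seminorm_ge0 gr).
(* Lengthening the sum to [N + M] allows a split at [N]: the first block vanishes, and the second is
   a block of the series of [x] beyond [N0]. *)
apply: le_trans (ler_sum_prefix pT0 (leq_addl N M)) _.
have := partial_sum_le_lnorm gr p (N + M) Lx.
have := ler_sum_prefix px0 N0N.
rewrite !big_split_ord /= [X in X + _ <= e]big1 => [|i _]; last first.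
  rewrite xT ltn_ord.
  exact: (seminorm0 (graded_lin gr i) (graded_seminorm p i)).
rewrite add0r; under [X in X <= e]eq_bigr => i _.
  rewrite xT ltnNge leq_addr /=; over.
lra.
Qed.

(** Density is stated for a constant times a finite sum of seminorms, the shape of the bounds in
    [sn_continuous], and with explicit approximants, the partial sums of [x]. *)
Lemma iota_dense (s : seq (Pidx Agr)) x (c e : R) : L x -> 0 < e ->
  exists N0, forall N, (N0 <= N)%N ->
    c * \sum_(p <- s) lnorm p (x - iota (\sum_(n < N) x n)) < e.
Proof.
move=> Lx e0.
have Lxa a : L (x - iota a) by apply: (subspaceB L_lin).
have [||N0 h] := @directed_small R nat (Pidx Agr) (fun M N : nat => (M <= N)%N)
  (fun p N _ => lnorm p (x - iota (\sum_(n < N) x n))) s c net_directed_nat _ _ e e0.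
- by move=> p N _; apply: (lnorm_ge0 gr).
- move=> p d d0; have d20 : 0 < d / 2 by lra.
  have [N0 h] := truncate_small p Lx d20; exists N0 => N _ N0N _.
  rewrite iotaA_sum //; last by case: Lx.
  by apply: le_lt_trans (h N N0N) _; lra.
by exists N0 => N N0N; apply: h.
Qed.

Lemma iota_approx (p : Pidx Agr) x (e : R) : L x -> 0 < e ->
  exists a, lnorm p (x - iota a) < e.
Proof.
move=> Lx e0; have [N0 /(_ N0 (leqnn _))] := iota_dense [:: p] 1 Lx e0.
by rewrite big_seq1 mul1r => h; exists (\sum_(n < N0) x n).
Qed.

(** Every seminorm on [A] is an index of [finest_lc], so the pullback of [lnorm p] along [iota] is
    its own bound. *)
Lemma iota_continuous : sn_continuous setT (@finest_lc R A) (@lnorm R A Agr) iota.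
Proof.
move=> p; have [iD [iZ _]] := iotaA_hom gr.
have sn : seminorm_on setT (fun a => lnorm p (iota a)).
  split=> [x y _ _|c x _].
    by rewrite iD //; apply: (seminormD (lnorm_seminorm gr p)).
  by rewrite iZ //; apply: (seminormZ (lnorm_seminorm gr p)).
by exists [:: exist _ _ sn], 1 => a _; rewrite big_seq1 mul1r.
Qed.

Variables (B : algType C) (IB : Type) (qB : IB -> B -> R).
Hypothesis B_AM : AM_algebra setT *%R 1 qB.
Let T_lin := @subspaceT R B.

Local Notation L_hom := (hom_on L (@seq_mul R A) (seq_one A) *%R 1).
Variable phi : A -> B.
Hypothesis phi_hom : hom_on setT *%R 1 *%R 1 phi.

(** For a far enough partial sum [a] of [x], both [psi1 x] and [psi2 x] lie within [e / 2] of
    [phi a]. *)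
Lemma L_hom_uniq (psi1 psi2 : (nat -> A) -> B) :
  L_hom psi1 -> sn_continuous L (@lnorm R A Agr) qB psi1 ->
  (forall a, psi1 (iota a) = phi a) ->
  L_hom psi2 -> sn_continuous L (@lnorm R A Agr) qB psi2 ->
  (forall a, psi2 (iota a) = phi a) ->
  forall x, L x -> psi1 x = psi2 x.
Proof.
move=> h1 c1 e1 h2 c2 e2 x Lx; have [_ [qsn [qH _]]] := B_AM.
apply/eqP; rewrite -subr_eq0; apply/eqP; apply: qH => // i.
apply/le_anti; rewrite (seminorm_ge0 T_lin (qsn i)) // andbT.
apply/ler_addgt0Pr => e e0; rewrite add0r; have e20 : 0 < e / 2 by lra.
have [s1 [k1 b1]] := c1 i; have [s2 [k2 b2]] := c2 i.
have [N1 a1] := iota_dense s1 k1 Lx e20; have [N2 a2] := iota_dense s2 k2 Lx e20.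
pose N := maxn N1 N2; pose a := \sum_(n < N) x n.
have Lxa : L (x - iota a) by apply: (subspaceB L_lin).
have := le_lt_trans (b1 _ Lxa) (a1 N (leq_maxl _ _)).
have := le_lt_trans (b2 _ Lxa) (a2 N (leq_maxr _ _)).
rewrite (hom_onB L_lin h1) // (hom_onB L_lin h2) // e1 e2 => l2 l1.
have -> : psi1 x - psi2 x = (psi1 x - phi a) - (psi2 x - phi a).
  by rewrite opprB addrA subrK.
by have := seminormB T_lin (qsn i) (x := psi1 x - phi a) (y := psi2 x - phi a) I I; lra.
Qed.

Variables (J : Type) (r : J -> B -> R).
Hypothesis r_sn : forall j, seminorm_on setT (r j) /\ submult_on setT *%R (r j).
Hypothesis qr : sn_equiv setT qB r.

Let rD j x y : r j (x + y) <= r j x + r j y.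
Proof. by case: (r_sn j) => h _; apply: (seminormD h). Qed.
Let rB j x y : r j (x - y) <= r j x + r j y.
Proof. by case: (r_sn j) => h _; apply: (seminormB T_lin h). Qed.
Let r_distC j x y : r j (x - y) = r j (y - x).
Proof. by case: (r_sn j) => h _; apply: (seminorm_distC T_lin h). Qed.
Let r_ge0 j x : 0 <= r j x.
Proof. by case: (r_sn j) => h _; apply: (seminorm_ge0 T_lin h). Qed.
Let rZ j (c : C) x : r j (c *: x) = Normc.normc c * r j x.
Proof. by case: (r_sn j) => h _; apply: (seminormZ h). Qed.
Let rM j x y : r j (x * y) <= r j x * r j y.
Proof. by case: (r_sn j) => _ h; apply: h. Qed.

(** Separation is given for [qB]; it passes to [r] because each [qB i] is dominated by finitely many
    [r j]. *)
Lemma r_hausdorff x y :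
  (forall j (e : R), 0 < e -> r j (x - y) <= e) -> x = y.
Proof.
move=> rxy; have [_ [qsn [qH _]]] := B_AM.
have r0 j : r j (x - y) = 0.
  apply/le_anti; rewrite r_ge0 andbT.
  by apply/ler_addgt0Pr => e e0; rewrite add0r; apply: rxy.
apply/eqP; rewrite -subr_eq0; apply/eqP; apply: qH => // i.
apply/le_anti; rewrite (seminorm_ge0 T_lin (qsn i)) // andbT.
have [s [c /(_ (x - y) I)]] := proj2 qr i.
by rewrite big1 ?mulr0.
Qed.

Lemma pullback_graded_submult j :
  graded_submult_seminorm Agr (fun _ a => r j (phi a)).
Proof.
have [pD [pZ [pM _]]] := phi_hom; split=> [n|i k a b _ _].
  by split=> [x y _ _|c x _]; rewrite ?pD ?pZ ?rD ?rZ.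
by rewrite pM ?rM.
Qed.

Definition pullback j : Pidx Agr := exist _ _ (pullback_graded_submult j).

Lemma r_phi_le j a : r j (phi a) <= lnorm (pullback j) (iota a).
Proof.
have [Af [N [_ aE]]] := components_decomposition gr a.
have phi_sum M (f : nat -> A) : phi (\sum_(n < M) f n) = \sum_(n < M) phi (f n).
  elim: M => [|M IH]; first by rewrite !big_ord0 (hom_on0 (@subspaceT R A) phi_hom).
  by have [pD _] := phi_hom; rewrite !big_ord_recr /= pD ?IH.
apply: le_trans (partial_sum_le_lnorm gr (pullback j) N (Liota a)).
rewrite {1}aE phi_sum.
exact: (seminorm_sum T_lin (proj1 (r_sn j))).
Qed.

(** Completeness is given for [qB], so the Cauchy condition is carried from [r] to [qB] and
    convergence back from [qB] to [r]. *)
Lemma r_complete (x : nat -> B) :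
  (forall j (e : R), 0 < e -> exists N0, forall M N, (N0 <= M)%N -> (N0 <= N)%N ->
     r j (x M - x N) < e) ->
  exists b, forall j (e : R), 0 < e -> exists N0, forall N, (N0 <= N)%N ->
     r j (x N - b) < e.
Proof.
move=> xC; have [_ [qsn [_ [qC _]]]] := B_AM.
have [||b [_ hb]] := qC _ _ x net_directed_nat => // [i e e0|].
  have [s [c qs]] := proj2 qr i.
  have [||N0 h] := @directed_small R nat J (fun M N : nat => (M <= N)%N)
    (fun j M N => r j (x M - x N)) s c net_directed_nat _ _ e e0 => //.
  by exists N0 => M N lM lN; apply: le_lt_trans (qs _ I) (h _ _ lM lN).
exists b => j e e0; have [s [c rs]] := proj1 qr j.
have [||N0 h] := @directed_small R nat IB (fun M N : nat => (M <= N)%N)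
  (fun i N _ => qB i (x N - b)) s c net_directed_nat _ _ e e0.
- by move=> i N _; apply: (seminorm_ge0 T_lin (qsn i)).
- by move=> i d d0; have [N0 h] := hb i d d0; exists N0 => N _ lN _; apply: h.
by exists N0 => N lN; apply: le_lt_trans (rs _ I) (h _ _ lN lN).
Qed.

(* This estimate determines [b]; since A is dense, all the properties of the
   extension x |-> b are read off from it. *)
Lemma extension_exists x : L x ->
  exists b, forall j a, r j (b - phi a) <= lnorm (pullback j) (x - iota a).
Proof.
move=> Lx; have [iD [iZ [iM _]]] := iotaA_hom gr.
have Lxa a : L (x - iota a) by apply: (subspaceB L_lin).
have iB a b : iota (a - b) = iota a - iota b.
  exact: (hom_onB (@subspaceT R A) (iotaA_hom gr)).
have pB a b : phi (a - b) = phi a - phi b.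
  exact: (hom_onB (@subspaceT R A) phi_hom).
(* Comparison through [x]: if [iota a] and [iota b] are close to [x], then [phi a] and [phi b] are
   close to each other. *)
have r_phiB j a b : r j (phi a - phi b) <=
    lnorm (pullback j) (x - iota a) + lnorm (pullback j) (x - iota b).
  rewrite r_distC -pB; apply: le_trans (r_phi_le _ _) _; rewrite iB.
  have -> : iota b - iota a = (x - iota a) - (x - iota b).
    by rewrite opprB [RHS]addrC addrA subrK.
  exact: (seminormB L_lin (lnorm_seminorm gr _)).
have approx j (e : R) : 0 < e -> exists N0, forall N, (N0 <= N)%N ->
    lnorm (pullback j) (x - iota (\sum_(n < N) x n)) < e.
  move=> e0; have [N0 h] := iota_dense [:: pullback j] 1 Lx e0.
  by exists N0 => N /h; rewrite big_seq1 mul1r.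
have [|b hb] := @r_complete (fun N => phi (\sum_(n < N) x n)) _.
  move=> j e e0; have e20 : 0 < e / 2 by lra.
  have [N0 h] := approx j _ e20; exists N0 => M N /h lM /h lN.
  by apply: le_lt_trans (r_phiB _ _ _) _; lra.
exists b => j a; apply/ler_addgt0Pr => e e0; have e20 : 0 < e / 2 by lra.
have [N0 h] := approx j _ e20; have [N1 h1] := hb j _ e20.
have la := h _ (leq_maxl N0 N1); have lb := h1 _ (leq_maxr N0 N1).
set a' := \sum_(n < _) x n in la lb.
rewrite r_distC in lb.
have -> : b - phi a = (b - phi a') + (phi a' - phi a) by rewrite addrA subrK.
apply: le_trans (rD _ _ _) _.
by have := r_phiB j a' a; move: la lb; lra.
Qed.

Lemma extension_hom : exists psi : (nat -> A) -> B,
  L_hom psi /\ sn_continuous L (@lnorm R A Agr) qB psi /\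
  forall a, psi (iota a) = phi a.
Proof.
have [iD [iZ [iM i1]]] := iotaA_hom gr; have [pD [pZ [pM p1]]] := phi_hom.
have [_ [L1 LM]] := lambdaPA_alg gr.
have lnD j x y : L x -> L y ->
    lnorm (pullback j) (x + y) <= lnorm (pullback j) x + lnorm (pullback j) y.
  exact: (seminormD (lnorm_seminorm gr _)).
have lnM j x y : L x -> L y ->
    lnorm (pullback j) (seq_mul x y) <= lnorm (pullback j) x * lnorm (pullback j) y.
  exact: (lnorm_submult gr).
(* Only the values of [psi] on [lambdaPA Agr] are constrained; 0 witnesses the vacuous case. *)
have /choice [psi hpsi] : forall x, exists b, L x ->
    forall j a, r j (b - phi a) <= lnorm (pullback j) (x - iota a).
  move=> x; have [Lx|nLx] := pselect (L x); last by exists 0.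
  by have [b] := extension_exists Lx; exists b.
have Lxa x a : L x -> L (x - iota a) by move=> Lx; apply: (subspaceB L_lin).
have ln0 (p : Pidx Agr) : lnorm p 0 = 0.
  exact: (seminorm0 L_lin (lnorm_seminorm gr p)).
have psi_iota a : psi (iota a) = phi a.
  apply: r_hausdorff => j e e0; apply: le_trans (hpsi _ (Liota a) _ _) _.
  by rewrite subrr ln0 ltW.
(* Continuity is the defining estimate at [a = 0]. *)
have psi_le j x : L x -> r j (psi x) <= lnorm (pullback j) x.
  move=> Lx; have := hpsi x Lx j 0.
  by rewrite (hom_on0 (@subspaceT R A) phi_hom)
    (hom_on0 (@subspaceT R A) (iotaA_hom gr)) !subr0.
exists psi; split; last first.
  split=> // i; have [s [c qs]] := proj2 qr i.
  exists (map pullback s), `|c| => x Lx; apply: le_trans (qs _ I) _.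
  rewrite big_map; apply: (@le_trans _ _ (`|c| * \sum_(j <- s) r j (psi x))).
    by apply: ler_wpM2r; [apply: sumr_ge0|apply: ler_norm].
  by apply: ler_wpM2l => //; apply: ler_sum => j _; apply: psi_le.
split; last split; last split.
(* The estimate for [x + y] costs two errors of [e / 4], those for [x] and [y] one each. *)
- move=> x y Lx Ly; apply: r_hausdorff => j e e0; have e40 : 0 < e / 4 by lra.
  have [a ha] := iota_approx (pullback j) Lx e40.
  have [b hb] := iota_approx (pullback j) Ly e40.
  have h1 := hpsi _ (subspaceD L_lin Lx Ly) j (a + b).
  have h2 := hpsi _ Lx j a; have h3 := hpsi _ Ly j b.
  have := lnD j _ _ (Lxa _ a Lx) (Lxa _ b Ly).
  rewrite iD // opprD addrACA in h1; rewrite pD // in h1 => h4.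
  have -> : psi (x + y) - (psi x + psi y) =
      (psi (x + y) - (phi a + phi b)) - ((psi x - phi a) + (psi y - phi b)).
    by rewrite addrACA -opprD opprB addrA subrK.
  have := rB j (psi (x + y) - (phi a + phi b)) ((psi x - phi a) + (psi y - phi b)).
  by have := rD j (psi x - phi a) (psi y - phi b); lra.
- move=> c x Lx; apply: r_hausdorff => j e e0.
  have nc0 : 0 <= Normc.normc c by case: (c) => u w; apply: sqrtr_ge0.
  (* Two errors occur, each the modulus of [c] times the distance from [x] to [iota a]; the added 1
     keeps [K] positive. *)
  pose K := 2 * Normc.normc c + 1; have K0 : 0 < K by rewrite /K; lra.
  have [a] := iota_approx (pullback j) Lx (divr_gt0 e0 K0).
  rewrite ltr_pdivlMr // /K => ha.
  have h1 := hpsi _ (subspaceZ L_lin c Lx) j (c *: a).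
  have h2 := hpsi _ Lx j a; have l0 := lnorm_ge0 gr (pullback j) (Lxa _ a Lx).
  rewrite iZ // pZ // -scalerBr (seminormZ (lnorm_seminorm gr _)) // in h1;
    last exact: Lxa.
  have -> : psi (c *: x) - c *: psi x =
      (psi (c *: x) - c *: phi a) - c *: (psi x - phi a).
    by rewrite scalerBr opprB addrA subrK.
  apply: le_trans (rB _ _ _) _; rewrite rZ.
  by have := ler_wpM2l nc0 h2; lra.
- move=> x y Lx Ly; apply: r_hausdorff => j e e0.
  set X := lnorm (pullback j) x; set Y := lnorm (pullback j) y.
  have X0 : 0 <= X by apply: (lnorm_ge0 gr).
  have Y0 : 0 <= Y by apply: (lnorm_ge0 gr).
  (* The four errors [g1] to [g4] below add up to [d * (2 * (X + Y + 1))]; [d <= 1] bounds the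
     approximants by [X + 1] and [Y + 1]. *)
  pose d := Num.min 1 (e / (2 * (X + Y + 1))).
  have K0 : 0 < 2 * (X + Y + 1) by lra.
  have d0 : 0 < d by rewrite /d lt_min ltr01 divr_gt0.
  have d1 : d <= 1 by rewrite /d ge_min lexx.
  have dK : d * (2 * (X + Y + 1)) <= e.
    by rewrite -ler_pdivlMr // /d ge_min lexx orbT.
  have [a /ltW ha] := iota_approx (pullback j) Lx d0.
  have [b /ltW hb] := iota_approx (pullback j) Ly d0.
  have iota_le z w : L z -> lnorm (pullback j) (z - iota w) <= d ->
      lnorm (pullback j) (iota w) <= lnorm (pullback j) z + 1.
    move=> Lz hz; have -> : iota w = z - (z - iota w) by rewrite opprB addrC subrK.
    have := seminormB L_lin (lnorm_seminorm gr (pullback j)) Lz (Lxa _ w Lz).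
    lra.
  have ia := iota_le _ _ Lx ha; have ib := iota_le _ _ Ly hb.
  have h1 := hpsi _ (LM _ _ Lx Ly) j (a * b).
  (* [seq_mul] is a bare function, so this telescoping identity is checked degree by degree. *)
  have mulE : seq_mul x y - iota (a * b) =
      seq_mul (x - iota a) y + seq_mul (iota a) (y - iota b).
    rewrite iM //; apply/funext => k; rewrite !fctE /seq_mul -sumrB -big_split /=.
    by apply: eq_bigr => i _; rewrite mulrBl mulrBr addrA subrK.
  have h2 := lnD j _ _ (LM _ _ (Lxa _ a Lx) Ly) (LM _ _ (Liota a) (Lxa _ b Ly)).
  have h3 := lnM j _ _ (Lxa _ a Lx) Ly; have h4 := lnM j _ _ (Liota a) (Lxa _ b Ly).
  rewrite mulE in h1.
  (* In [B] the telescoping keeps the factors [phi b] and [psi x], bounded by [Y + 1] and [X]. *)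
  have -> : psi (seq_mul x y) - psi x * psi y =
      (psi (seq_mul x y) - phi (a * b)) -
      ((psi x - phi a) * phi b + psi x * (psi y - phi b)).
    have -> : (psi x - phi a) * phi b + psi x * (psi y - phi b) =
        psi x * psi y - phi a * phi b by rewrite mulrBl mulrBr addrC addrA subrK.
    by rewrite pM // opprB addrA subrK.
  have h5 := rB j (psi (seq_mul x y) - phi (a * b))
    ((psi x - phi a) * phi b + psi x * (psi y - phi b)).
  have h6 := rD j ((psi x - phi a) * phi b) (psi x * (psi y - phi b)).
  have h7 := rM j (psi x - phi a) (phi b); have h8 := rM j (psi x) (psi y - phi b).
  have g1 : lnorm (pullback j) (x - iota a) * Y <= d * Y by apply: ler_wpM2r.
  have g2 : lnorm (pullback j) (iota a) * lnorm (pullback j) (y - iota b)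
      <= (X + 1) * d by apply: ler_pM => //; apply: (lnorm_ge0 gr) => //; apply: Lxa.
  have g3 : r j (psi x - phi a) * r j (phi b) <= d * (Y + 1).
    apply: ler_pM => //; first exact: le_trans (hpsi _ Lx _ _) ha.
    exact: le_trans (r_phi_le _ _) ib.
  have g4 : r j (psi x) * r j (psi y - phi b) <= X * d.
    by apply: ler_pM => //; [apply: psi_le|apply: le_trans (hpsi _ Ly _ _) hb].
  rewrite -/Y in h3; lra.
- by rewrite -i1 psi_iota.
Qed.

End Universal.

Theorem theorem6p24 (R : realType) (A : algType R[i]) (Agr : nat -> set A) :
  graded_algebra Agr -> locally_finite Agr ->
  alg_closed_on (lambdaPA Agr) (@seq_mul R A) (seq_one A) /\
  AM_envelope (@finest_lc R A)
    (lambdaPA Agr) (@seq_mul R A) (seq_one A) (@lnorm R A Agr) (iotaA Agr).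
Proof.
move=> gr lf; have alg := lambdaPA_alg gr.
have [m [v [c coordP]]] := locally_finite_coordinates gr lf.
split=> //; split; last split; last split; last split.
- split=> //; split; first exact: lnorm_seminorm.
  split; first exact: (lnorm_hausdorff gr coordP).
  split; first exact: (lnorm_complete gr coordP).
  (* The defining seminorms are themselves submultiplicative, so the same family serves as [r]. *)
  exists (Pidx Agr), (@lnorm R A Agr); split; last by split; apply: sn_continuous_id.
  by move=> p; split; [apply: lnorm_seminorm|apply: lnorm_submult].
- exact: iotaA_lambdaPA.
- exact: iotaA_hom.
- exact: iota_continuous.
- move=> B IB qB B_AM phi phi_hom _; split.
    have [_ [_ [_ [_ [J [r [r_sn qr]]]]]]] := B_AM.
    exact: (extension_hom gr B_AM phi_hom r_sn qr).
  exact: (L_hom_uniq gr B_AM).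
Qed.
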